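(* Consider the one-dimensional viscous Burgers equation $u_t+f(u)_x=\mu u_{xx}$, $f(u)=\frac12u^2$, with constant $\mu>0$, and its relaxation system $u_t+v_x=0$, $v_t+(\frac{\mu}{\epsilon}+a^2)u_x=\frac{1}{\epsilon}(f(u)-v)$. For $\epsilon\ll1$, suppose that $$\Delta x=O(\epsilon^\alpha),\qquad \Delta t=\frac{CFL\,\Delta x}{\sqrt{\mu/\epsilon+a^2}}=O(\epsilon^{\beta}),\qquad CFL\in(0,1),$$ with $\frac16<\alpha<\frac12$ and $\frac23<\beta=\alpha+\frac12<1$. Then the upwind type relaxation scheme with second-order accuracy in space (defined in the context) is asymptotic preserving (AP) in a coarse regime at the cell resolution $\Delta x=o(\epsilon^{1/6})$ and $\Delta t=o(\epsilon^{2/3})$.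
   Context: Setting. $u$ takes values in a state domain $\mathcal{D}\subset\mathbb{R}$, $v\in\mathbb{R}$ is an artificial variable, $\epsilon>0$ is the relaxation parameter, and $a$ is a constant with $|f'(u)|\le\sqrt{\mu/\epsilon+a^2}$ for all $u\in\mathcal{D}$. Put $U=(u,v)^\top$, $$F(U)=\begin{pmatrix}v\\(\frac{\mu}{\epsilon}+a^2)u\end{pmatrix},\quad H(U)=\begin{pmatrix}0\\\frac1\epsilon(f(u)-v)\end{pmatrix},\quad M=\begin{pmatrix}0&1\\\frac{\mu}{\epsilon}+a^2&0\end{pmatrix}.$$ The scheme. On a uniform mesh with cell centers $x_j$, size $\Delta x$ and time step $\Delta t$, the cell values $U_j^n$ are updated by $$U^{n+1}_j=U^n_j-\frac{\Delta t}{\Delta x}\left(F(U^n_{j+1/2})-F(U^n_{j-1/2})\right)+\Delta t\,H(U^{n+1}_j),$$ $$U^n_{j+1/2}=\tfrac12\left(U^{n,l}_{j+1/2}+U^{n,r}_{j+1/2}\right)-\frac{1}{2\sqrt{\mu/\epsilon+a^2}}M\left(U^{n,r}_{j+1/2}-U^{n,l}_{j+1/2}\right),$$ where $U^{n,l}_{j+1/2}=U^n_j+\frac{\Delta x}{2}(U_x)^n_j$, $U^{n,r}_{j+1/2}=U^n_{j+1}-\frac{\Delta x}{2}(U_x)^n_{j+1}$ and $(U_x)^n_j=(U^n_{j+1}-U^n_{j-1})/(2\Delta x)$. Definition (AP in a coarse regime). Let $P^\epsilon_h$, $h=(\Delta x,\Delta t)$, be a consistent numerical scheme for the relaxation system (consistent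 for fixed $\epsilon$ as $\Delta x,\Delta t\to0$). Let $\Delta x=O(\epsilon^\alpha)$ and $\Delta t=O(\epsilon^\beta)$ with $\alpha_0<\alpha<1$, $\beta_0<\beta<1$, $\alpha_0,\beta_0\in[0,1)$. Then $P^\epsilon_h$ is called AP in a coarse regime at the cell resolution $\Delta x=o(\epsilon^{\alpha_0})$ and $\Delta t=o(\epsilon^{\beta_0})$ if $P^\epsilon_h\to P^0_0$ as $\epsilon\to0$, where $P^0_0$ denotes the original equation (here the viscous Burgers equation). Meaning of $P^\epsilon_h\to P^0_0$: it is understood in the sense of the asymptotic modified equation. Represent the numerical solution by smooth functions $U_h=(u_h,v_h)$ of $(x,t)$ satisfying the scheme's difference equations at every $(x,t)$ (with $U^{n}_{j}$ replaced by $U_h(x,t)$, $U^{n}_{j\pm1}$ by $U_h(x\pm\Delta x,t)$, etc., and $U^{n+1}_j$ by $U_h(x,t+\Delta t)$), with derivatives bounded uniformly in $\epsilon$. If $u_h=u_h^{(0)}+\epsilon u_h^{(1)}+O(\epsilon^2)$ (Chapman-Enskog expansion, differentiable term by term), then the leading order term $u^{(0)}_h$ satisfies $\partial_tu^{(0)}_h+\partial_xf(u^{(0)}_h)=\mu\,\partial_x^2u^{(0)}_h$. *)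

(* Defs.v *)
From Stdlib Require Export Reals Lra ZArith.
From Coquelicot Require Export Coquelicot.

Open Scope R_scope.

(** Throughout, "for [eps << 1]" is "eventually along [at_right 0]", and
    space-time is the open half-plane [{(x, t) | 0 < t}]. *)

Definition burgers_flux (u : R) : R := / 2 * u ^ 2.

(** Column vectors [U = (u, v)^T]; [plus], [minus] and [scal] are Coquelicot's
    componentwise operations on [R * R]. *)
Definition state : Type := (R * R)%type.

Definition char_speed (mu a eps : R) : R := sqrt (mu / eps + a ^ 2).

Definition relax_F (mu a eps : R) (U : state) : state :=
  (snd U, (mu / eps + a ^ 2) * fst U).

Definition relax_H (f : R -> R) (eps : R) (U : state) : state :=
  (0, / eps * (f (fst U) - snd U)).

Definition relax_M (mu a eps : R) (U : state) : state :=
  (0 * fst U + 1 * snd U, (mu / eps + a ^ 2) * fst U + 0 * snd U).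

(** A scheme is given by the right-hand side of its update formula: [Un] and
    [Un1] are the cell values at the levels [n] and [n + 1], and the difference
    equation of cell [j] is [Un1 j = P eps dx dt Un Un1 j]. *)
Definition scheme : Type :=
  R -> R -> R -> (Z -> state) -> (Z -> state) -> Z -> state.

Definition slope (dx : R) (U : Z -> state) (j : Z) : state :=
  scal (/ (2 * dx)) (minus (U (j + 1)%Z) (U (j - 1)%Z) : state).

(** The left and right values and the upwind value at the interface
    [j + 1/2] are indexed by [j]. *)
Definition left_value (dx : R) (U : Z -> state) (j : Z) : state :=
  plus (U j) (scal (dx / 2) (slope dx U j) : state).

Definition right_value (dx : R) (U : Z -> state) (j : Z) : state :=
  minus (U (j + 1)%Z) (scal (dx / 2) (slope dx U (j + 1)%Z) : state).

Definition interface_value (mu a eps dx : R) (U : Z -> state) (j : Z) : state :=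
  minus
    (scal (/ 2) (plus (left_value dx U j) (right_value dx U j) : state) : state)
    (scal (/ (2 * char_speed mu a eps))
       (relax_M mu a eps (minus (right_value dx U j) (left_value dx U j)))).

Definition upwind_scheme (f : R -> R) (mu a : R) : scheme :=
  fun eps dx dt Un Un1 j =>
  plus
    (minus (Un j)
       (scal (dt / dx)
          (minus (relax_F mu a eps (interface_value mu a eps dx Un j))
                 (relax_F mu a eps (interface_value mu a eps dx Un (j - 1)%Z)) : state)
        : state) : state)
    (scal dt (relax_H f eps (Un1 j))).

Definition sample (u v : R -> R -> R) (dx x t : R) : Z -> state :=
  fun k => (u (x + IZR k * dx) t, v (x + IZR k * dx) t).

Definition satisfies_scheme (P : scheme) (eps dx dt : R)
    (u v : R -> R -> R) : Prop :=
  forall x t, 0 < t ->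
    sample u v dx x (t + dt) 0%Z
    = P eps dx dt (sample u v dx x t) (sample u v dx x (t + dt)) 0%Z.

Definition smooth (u : R -> R -> R) : Prop :=
  forall n x t, 0 < t -> ex_diff_n u n x t.

Definition relaxation_operator (f : R -> R) (mu a eps : R)
    (u v : R -> R -> R) (x t : R) : state :=
  (Derive (fun s => u x s) t + Derive (fun y => v y t) x,
   Derive (fun s => v x s) t + (mu / eps + a ^ 2) * Derive (fun y => u y t) x
     - / eps * (f (u x t) - v x t)).

Definition difference_operator (P : scheme) (eps dx dt : R)
    (u v : R -> R -> R) (x t : R) : state :=
  scal (/ dt)
    (minus (sample u v dx x (t + dt) 0%Z)
       (P eps dx dt (sample u v dx x t) (sample u v dx x (t + dt)) 0%Z)
     : state).

(** For each fixed [eps], the truncation error of every smooth function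
    vanishes as [dx] and [dt] tend to [0] independently. *)
Definition consistent (f : R -> R) (mu a : R) (P : scheme) : Prop :=
  forall eps, 0 < eps ->
  forall u v, smooth u -> smooth v ->
  forall x t, 0 < t ->
    filterlim
      (fun h : R * R =>
         (minus (difference_operator P eps (fst h) (snd h) u v x t)
                (relaxation_operator f mu a eps u v x t) : state))
      (filter_prod (at_right 0) (at_right 0))
      (locally ((0, 0) : state)).

Definition big_O (g h : R -> R) : Prop :=
  exists C, at_right 0 (fun eps => Rabs (h eps) <= C * Rabs (g eps)).

Definition in_box (r x t : R) : Prop := Rabs x <= r /\ / r <= t <= r.

(** The sets [in_box r], [0 < r], exhaust the open half-plane by compact sets. *)
Definition locally_bounded_in_eps (g : R -> R -> R -> R) : Prop :=
  forall r, 0 < r ->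
  exists C, at_right 0 (fun eps =>
    forall x t, in_box r x t -> Rabs (g eps x t) <= C).

(** [u_h = u0 + eps * u1 + O(eps^2)], differentiable term by term.  The
    coefficients may depend on [eps] through [h = (dx, dt)]. *)
Definition has_expansion (u u0 u1 : R -> R -> R -> R) : Prop :=
  at_right 0 (fun eps => smooth (u0 eps) /\ smooth (u1 eps)) /\
  forall m k : nat,
    locally_bounded_in_eps (fun eps => partial_derive m k (u0 eps)) /\
    locally_bounded_in_eps (fun eps => partial_derive m k (u1 eps)) /\
    locally_bounded_in_eps (fun eps x t =>
      (partial_derive m k (u eps) x t
       - (partial_derive m k (u0 eps) x t
          + eps * partial_derive m k (u1 eps) x t)) / eps ^ 2).

Definition viscous_residual (f : R -> R) (mu : R) (w : R -> R -> R)
    (x t : R) : R :=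
  Derive (fun s => w x s) t + Derive (fun y => f (w y t)) x
  - mu * Derive_n (fun y => w y t) 2 x.

(** [P^eps_h -> P^0_0].  Coefficients that do not depend on [eps] have a leading
    term solving the viscous equation exactly; for coefficients depending on
    [h], hence on [eps], the splitting [u0 + eps * u1] is not unique and the
    equation can only hold in the limit [eps -> 0]. *)
Definition converges_to_viscous (f : R -> R) (mu : R) (D : R -> Prop)
    (P : scheme) (dx dt : R -> R) : Prop :=
  forall u v : R -> R -> R -> R,
  at_right 0 (fun eps =>
    smooth (u eps) /\ smooth (v eps) /\
    (forall x t, 0 < t -> D (u eps x t)) /\
    satisfies_scheme P eps (dx eps) (dt eps) (u eps) (v eps)) ->
  (forall m k : nat, (0 < m + k)%nat ->
    locally_bounded_in_eps (fun eps => partial_derive m k (u eps)) /\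
    locally_bounded_in_eps (fun eps => partial_derive m k (v eps))) ->
  (forall w0 w1 : R -> R -> R,
    has_expansion u (fun _ => w0) (fun _ => w1) ->
    forall x t, 0 < t -> viscous_residual f mu w0 x t = 0) /\
  (forall u0 u1 : R -> R -> R -> R,
    has_expansion u u0 u1 ->
    forall r eta, 0 < r -> 0 < eta ->
    at_right 0 (fun eps =>
      forall x t, in_box r x t ->
        Rabs (viscous_residual f mu (u0 eps) x t) <= eta)).

(** [is_domin F g h] is [h = o(g)] along [F]. *)
Definition AP_coarse_regime (f : R -> R) (mu a : R) (D : R -> Prop)
    (P : scheme) (alpha0 beta0 alpha beta : R) (dx dt : R -> R) : Prop :=
  consistent f mu a P /\
  (0 <= alpha0 < 1 /\ 0 <= beta0 < 1) /\
  (alpha0 < alpha < 1 /\ beta0 < beta < 1) /\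
  (big_O (fun eps => Rpower eps alpha) dx /\
   big_O (fun eps => Rpower eps beta) dt) /\
  (is_domin (at_right 0) (fun eps => Rpower eps alpha0) dx /\
   is_domin (at_right 0) (fun eps => Rpower eps beta0) dt) /\
  converges_to_viscous f mu D P dx dt.

(* Main.v *)
(** The update reads
      (u(t+dt) - u) / dt + Dv / dx + c/(8 dx) delta^4 u = 0,
      (v(t+dt) - v) / dt + c^2 Du / dx + c/(8 dx) delta^4 v
        = (f(u(t+dt)) - v(t+dt)) / eps,
    with [c^2 = mu/eps + a^2] and [D] a centered difference.  Multiplying the second
    equation by [eps], where [eps c^2 = mu + O(eps)], and differentiating it in [x]
    gives [v_x = f(u)_x - mu u_xx + o(1)] as soon as the derivatives are bounded.
    Inserted into the first equation, this leaves the residual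
    [O(dx + dt + eps + c dx^3)] for the viscous equation, and [c dx^3 -> 0] because
    [alpha > 1/6].  The boundedness of [u] itself, needed for [f(u)_x = u u_x], comes
    from the expansion. *)

From Stdlib Require Import Lia.
Require Import Defs.

(** * Partial derivatives and the mean value inequality *)

Lemma is_derive_partial_x (p q : nat) (u : R -> R -> R) (x t : R) :
  smooth u -> 0 < t ->
  is_derive (fun y => partial_derive p q u y t) x (partial_derive (S p) q u x t).
Proof.
intros Hu Ht.
apply (Derive_correct (fun y => partial_derive p q u y t)).
apply ex_diff_n_ex_deriv_inf_1 with (n := S (p + q)); [lia | now apply Hu].
Qed.

(** [partial_derive] applies the time derivatives first, so one more of them has to be commuted past
    the space derivatives. This needs smoothness on a neighbourhood, here the ball of radius [t],
    which stays in the half-plane. *)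
Lemma is_derive_partial_t (p q : nat) (u : R -> R -> R) (x t : R) :
  smooth u -> 0 < t ->
  is_derive (fun s => partial_derive p q u x s) t (partial_derive p (S q) u x t).
Proof.
intros Hu Ht.
rewrite <- Derive_partial_derive.
- apply Derive_correct.
  apply ex_diff_n_ex_deriv_inf_2 with (n := S (p + q)); [lia | now apply Hu].
- exists (mkposreal t Ht); simpl; intros y s _ Hs.
  apply Hu; apply Rabs_def2 in Hs; lra.
Qed.

Lemma mvt_bound (f df : R -> R) (x y B : R) :
  (forall z, Rmin x y <= z <= Rmax x y -> is_derive f z (df z) /\ Rabs (df z) <= B) ->
  Rabs (f y - f x) <= B * Rabs (y - x).
Proof.
intros H.
destruct (MVT_gen f x y df) as [z [Hz E]].
- intros z Hz; apply H; lra.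
- intros z Hz; apply derivable_continuous_pt.
  exists (df z); apply is_derive_Reals, H, Hz.
- rewrite E, Rabs_mult.
  apply Rmult_le_compat_r; [apply Rabs_pos | apply H, Hz].
Qed.

(** * Finite differences and the closed form of the scheme *)

(** Not divided by the step, so it approximates [h * g']. The weights arise when the averages of the
    left and right interface values are subtracted between neighbouring interfaces. *)
Definition central_diff (h : R) (g : R -> R) (x : R) : R :=
  3 / 4 * (g (x + h) - g (x - h)) - / 8 * (g (x + 2 * h) - g (x - 2 * h)).

(** Also undivided. Its square is the fourth difference, which is what the jumps of the
    reconstruction at the two interfaces of a cell produce. *)
Definition second_diff (h : R) (g : R -> R) (x : R) : R :=
  g (x + h) - 2 * g x + g (x - h).

Lemma is_derive_shift (g dg : R -> R) (s x : R) :
  (forall y, is_derive g y (dg y)) ->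
  is_derive (fun y => g (y + s)) x (dg (x + s)).
Proof.
intros Hg.
replace (dg (x + s)) with (1 * dg (x + s)) by ring.
apply (is_derive_comp g (fun y => y + s)); [apply Hg |].
auto_derive; [trivial | ring].
Qed.

Lemma is_derive_second_diff (g dg : R -> R) (h x : R) :
  (forall y, is_derive g y (dg y)) ->
  is_derive (second_diff h g) x (second_diff h dg x).
Proof.
intros Hg; unfold second_diff.
apply (is_derive_plus (fun x => g (x + h) - 2 * g x) (fun x => g (x - h))).
- apply (is_derive_minus (fun x => g (x + h)) (fun x => 2 * g x)).
  + now apply is_derive_shift.
  + apply is_derive_scal, Hg.
- now apply is_derive_shift.
Qed.

Lemma is_derive_central_diff (g dg : R -> R) (h x : R) :
  (forall y, is_derive g y (dg y)) ->
  is_derive (central_diff h g) x (central_diff h dg x).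
Proof.
intros Hg; unfold central_diff.
assert (Hd : forall s, is_derive (fun y => g (y + s) - g (y - s)) x
  (dg (x + s) - dg (x - s))).
{ intros s.
  apply (is_derive_minus (fun x => g (x + s)) (fun x => g (x - s)));
    now apply is_derive_shift. }
apply (is_derive_minus (fun y => 3 / 4 * (g (y + h) - g (y - h)))
  (fun y => / 8 * (g (y + 2 * h) - g (y - 2 * h)))); apply is_derive_scal, Hd.
Qed.

(** On the interval [g1] strays from [g1 x] by at most [B * s], and the mean value inequality for
    [g y - (y - x) * g1 x] over the length [2 * s] does the rest. The remainder is only quadratic,
    which suffices for a limit. *)
Lemma symmetric_diff_bound (g g1 g2 : R -> R) (x s B : R) :
  (forall y, is_derive g y (g1 y)) -> (forall y, is_derive g1 y (g2 y)) ->
  0 <= s ->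
  (forall y, Rabs (y - x) <= s -> Rabs (g2 y) <= B) ->
  Rabs (g (x + s) - g (x - s) - 2 * s * g1 x) <= 2 * s ^ 2 * B.
Proof.
intros H1 H2 Hs HB.
assert (HB1 : forall y, Rabs (y - x) <= s -> Rabs (g1 y - g1 x) <= B * s).
{ intros y Hy.
  assert (HB0 : 0 <= B).
  { apply Rle_trans with (1 := Rabs_pos (g2 x)), HB.
    now rewrite Rminus_diag, Rabs_R0. }
  apply Rle_trans with (B * Rabs (y - x)); [| now apply Rmult_le_compat_l].
  apply mvt_bound with (df := g2); intros z Hz; split; [apply H2 | apply HB].
  revert Hy Hz; unfold Rmin, Rmax; destruct (Rle_dec x y); intros;
    split_Rabs; lra. }
replace (g (x + s) - g (x - s) - 2 * s * g1 x) with
  ((fun y => g y - (y - x) * g1 x) (x + s) - (fun y => g y - (y - x) * g1 x) (x - s))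
  by (cbv beta; ring).
replace (2 * s ^ 2 * B) with ((B * s) * Rabs (x + s - (x - s)))
  by (rewrite Rabs_pos_eq; [ring | lra]).
apply (mvt_bound (fun y => g y - (y - x) * g1 x) (fun y => g1 y - g1 x)).
intros z; rewrite Rmin_left, Rmax_right by lra; intros Hz; split.
- replace (g1 z - g1 x) with (minus (g1 z) (g1 x)) by reflexivity.
  apply (is_derive_minus g (fun y => (y - x) * g1 x)); [apply H1 |].
  auto_derive; [trivial | ring].
- apply HB1; split_Rabs; lra.
Qed.

(** The constant is [5 / 2 = 3 / 4 * 2 + / 8 * 8], from the symmetric differences with steps [h] and
    [2 * h]. *)
Lemma central_diff_bound (g g1 g2 : R -> R) (x h B : R) :
  (forall y, is_derive g y (g1 y)) -> (forall y, is_derive g1 y (g2 y)) ->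
  0 <= h ->
  (forall y, Rabs (y - x) <= 2 * h -> Rabs (g2 y) <= B) ->
  Rabs (central_diff h g x - h * g1 x) <= h * (5 / 2 * h * B).
Proof.
intros H1 H2 Hh HB.
assert (E1 : Rabs (g (x + h) - g (x - h) - 2 * h * g1 x) <= 2 * h ^ 2 * B).
{ apply symmetric_diff_bound with g2; try assumption.
  intros y Hy; apply HB; lra. }
assert (E2 : Rabs (g (x + 2 * h) - g (x - 2 * h) - 2 * (2 * h) * g1 x)
  <= 2 * (2 * h) ^ 2 * B).
{ apply symmetric_diff_bound with g2; try assumption; lra. }
unfold central_diff.
apply Rabs_le_between in E1, E2.
apply Rabs_le_between; nra.
Qed.

(** The even combination [k s = g (x + s) + g (x - s)] has derivative at most [2 * s * B], so
    [k h - k 0] is quadratic in [h]. *)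
Lemma second_diff_bound (g g1 g2 : R -> R) (x h B : R) :
  (forall y, is_derive g y (g1 y)) -> (forall y, is_derive g1 y (g2 y)) ->
  0 <= h ->
  (forall y, Rabs (y - x) <= h -> Rabs (g2 y) <= B) ->
  Rabs (second_diff h g x) <= 2 * h ^ 2 * B.
Proof.
intros H1 H2 Hh HB.
assert (HB0 : 0 <= B).
{ apply Rle_trans with (1 := Rabs_pos (g2 x)), HB.
  now rewrite Rminus_diag, Rabs_R0. }
set (k := fun s => g (x + s) + g (x - s)).
replace (second_diff h g x) with (k h - k 0)
  by (unfold k, second_diff; rewrite Rplus_0_r, Rminus_0_r; ring).
replace (2 * h ^ 2 * B) with ((2 * h * B) * Rabs (h - 0))
  by (rewrite Rminus_0_r, (Rabs_pos_eq h) by lra; ring).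
apply mvt_bound with (df := fun s => g1 (x + s) - g1 (x - s)).
intros s; rewrite Rmin_left, Rmax_right by lra; intros Hs; split.
- unfold k; apply (is_derive_plus (fun s => g (x + s)) (fun s => g (x - s))).
  + replace (g1 (x + s)) with (1 * g1 (x + s)) by ring.
    apply (is_derive_comp g (fun s => x + s)); [apply H1 |].
    auto_derive; [trivial | ring].
  + replace (- g1 (x - s)) with (-1 * g1 (x - s)) by ring.
    apply (is_derive_comp g (fun s => x - s)); [apply H1 |].
    auto_derive; [trivial | ring].
- apply Rle_trans with (B * Rabs (x + s - (x - s))).
  + apply mvt_bound with (df := g2).
    intros z; rewrite Rmin_left, Rmax_right by lra; intros Hz.
    split; [apply H2 | apply HB; split_Rabs; lra].
  + rewrite Rabs_pos_eq by lra; nra.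
Qed.

(** Second differences commute with differentiation, so the previous bound is applied to
    [second_diff h g] and then to [g2]; the two steps together reach distance [2 * h]. *)
Lemma fourth_diff_bound (g g1 g2 g3 g4 : R -> R) (x h B : R) :
  (forall y, is_derive g y (g1 y)) -> (forall y, is_derive g1 y (g2 y)) ->
  (forall y, is_derive g2 y (g3 y)) -> (forall y, is_derive g3 y (g4 y)) ->
  0 <= h ->
  (forall y, Rabs (y - x) <= 2 * h -> Rabs (g4 y) <= B) ->
  Rabs (second_diff h (second_diff h g) x) <= 4 * h ^ 4 * B.
Proof.
intros H1 H2 H3 H4 Hh HB.
replace (4 * h ^ 4 * B) with (2 * h ^ 2 * (2 * h ^ 2 * B)) by ring.
apply second_diff_bound with (second_diff h g1) (second_diff h g2); trivial.
- intros y; now apply is_derive_second_diff.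
- intros y; now apply is_derive_second_diff.
- intros y Hy; apply second_diff_bound with g3 g4; trivial.
  intros z Hz; apply HB; split_Rabs; lra.
Qed.

(* Since [F U = M U] and [M^2 = c^2 Id] with [c] the characteristic speed, the
   upwind correction of the flux acts on each component separately. *)
Lemma upwind_scheme_sample (f : R -> R) (mu a eps dx dt x t : R)
    (u v : R -> R -> R) (Un1 : Z -> state) :
  0 < mu / eps + a ^ 2 -> dx <> 0 ->
  upwind_scheme f mu a eps dx dt (sample u v dx x t) Un1 0%Z
  = (u x t - dt / dx *
       (central_diff dx (fun y => v y t) x
        + char_speed mu a eps / 8 *
          second_diff dx (second_diff dx (fun y => u y t)) x),
     v x t - dt / dx *
       ((mu / eps + a ^ 2) * central_diff dx (fun y => u y t) x
        + char_speed mu a eps / 8 *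
          second_diff dx (second_diff dx (fun y => v y t)) x)
     + dt * (/ eps * (f (fst (Un1 0%Z)) - snd (Un1 0%Z)))).
Proof.
intros HK Hdx.
assert (Hc : 0 < char_speed mu a eps) by now apply sqrt_lt_R0.
assert (Ec : mu / eps + a ^ 2 = char_speed mu a eps * char_speed mu a eps)
  by (symmetry; apply sqrt_sqrt; lra).
unfold upwind_scheme, relax_F, interface_value, relax_M, left_value, right_value,
  slope, sample, relax_H, central_diff, second_diff.
rewrite Ec; set (c := char_speed mu a eps) in *.
unfold minus, plus, opp, scal; simpl; unfold prod_plus, prod_opp, prod_scal; simpl.
unfold plus, opp, scal; simpl; unfold mult; simpl.
replace (x + dx + dx) with (x + 2 * dx) by ring.
replace (x + dx - dx) with x by ring.
replace (x - dx + dx) with x by ring.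
replace (x - dx - dx) with (x + -2 * dx) by ring.
replace (x - 2 * dx) with (x + -2 * dx) by ring.
replace (x - dx) with (x + -1 * dx) by ring.
replace (x + 1 * dx) with (x + dx) by ring.
replace (x + 0 * dx) with x by ring.
(* With [/ eps] an atom, [field] raises no side condition on [eps]. *)
generalize (/ eps); intros e.
f_equal; field; split; trivial; lra.
Qed.

(** * The modified equation: residual of a solution of the scheme *)

Lemma viscous_residual_burgers (mu : R) (w : R -> R -> R) (x t : R) :
  smooth w -> 0 < t ->
  viscous_residual burgers_flux mu w x t
  = partial_derive 0 1 w x t + w x t * partial_derive 1 0 w x t
    - mu * partial_derive 2 0 w x t.
Proof.
intros Hw Ht; unfold viscous_residual.
assert (E : Derive (fun y => burgers_flux (w y t)) x
  = w x t * partial_derive 1 0 w x t).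
{ apply is_derive_unique; unfold burgers_flux.
  assert (H := is_derive_partial_x 0 0 w x t Hw Ht).
  change (is_derive (fun y => w y t) x (partial_derive 1 0 w x t)) in H.
  evar_last; [apply is_derive_scal, is_derive_pow, H |].
  simpl; field. }
rewrite E; reflexivity.
Qed.

(** Turns an error bound into an exact identity with a named remainder, so that the difference
    equations can be solved by algebra and estimated only at the end. *)
Lemma exists_remainder (X Y h b : R) :
  0 < h -> Rabs (X - h * Y) <= h * b ->
  exists e, X = h * (Y + e) /\ Rabs e <= b.
Proof.
intros Hh H; exists ((X - h * Y) / h); split; [field; lra |].
unfold Rdiv; rewrite Rabs_mult, Rabs_inv, (Rabs_pos_eq h) by lra.
apply Rmult_le_reg_l with h; [assumption |].
replace (h * (Rabs (X - h * Y) * / h)) with (Rabs (X - h * Y)) by (field; lra).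
assumption.
Qed.

Lemma increment_remainder (f df : R -> R) (x h B : R) :
  0 < h ->
  (forall z, x <= z <= x + h -> is_derive f z (df z) /\ Rabs (df z) <= B) ->
  exists e, f (x + h) - f x = h * e /\ Rabs e <= B.
Proof.
intros Hh H.
destruct (exists_remainder (f (x + h) - f x) 0 h B Hh) as [e [E He]].
- rewrite Rmult_0_r, Rminus_0_r, (Rmult_comm h).
  replace (B * h) with (B * Rabs (x + h - x))
    by (rewrite Rabs_pos_eq by lra; ring).
  apply mvt_bound with df; intros z; rewrite Rmin_left, Rmax_right by lra.
  apply H.
- exists e; now rewrite E, Rplus_0_l.
Qed.

(** The stencil reaches at most distance 1 in space and time 1 forward; a box with radius larger by
    1 contains it, and its lower time limit only decreases. *)
Lemma in_box_near (r x t y s : R) :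
  0 < r -> in_box r x t -> Rabs (y - x) <= 1 -> t <= s <= t + 1 ->
  in_box (r + 1) y s.
Proof.
intros Hr [Hx Ht] Hy Hs.
split; [split_Rabs; lra | split; [| lra]].
apply Rle_trans with (/ r); [apply Rinv_le_contravar; lra | lra].
Qed.

Lemma in_box_pos (r x t : R) : 0 < r -> in_box r x t -> 0 < t.
Proof.
intros Hr [_ Ht]; apply Rlt_le_trans with (/ r); [now apply Rinv_0_lt_compat | lra].
Qed.

(* The flux difference of the first component is the only place where the
   stiffness [c = O(eps^(-1/2))] is not compensated by [eps]; it produces the
   numerical viscosity [c dx^3], whence the threshold [dx = o(eps^(1/6))]. *)
Lemma modified_equation_estimate (mu a eps dx dt r B : R) (u v : R -> R -> R) :
  0 < mu -> 0 < eps <= 1 -> 0 < dx <= 1 / 2 -> 0 < dt <= 1 -> 0 < r ->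
  smooth u -> smooth v ->
  satisfies_scheme (upwind_scheme burgers_flux mu a) eps dx dt u v ->
  (forall x t, in_box (r + 1) x t -> forall m k, (m <= 5)%nat -> (k <= 5)%nat ->
     Rabs (partial_derive m k u x t) <= B) ->
  (forall x t, in_box (r + 1) x t -> forall m k, (m <= 5)%nat -> (k <= 5)%nat ->
     (0 < m + k)%nat -> Rabs (partial_derive m k v x t) <= B) ->
  forall x t, in_box r x t ->
  Rabs (viscous_residual burgers_flux mu u x t)
  <= B * (6 + 2 * B + a ^ 2 + 3 * (mu + a ^ 2))
     * (dx + dt + eps + char_speed mu a eps * dx ^ 3).
Proof.
intros Hmu Heps Hdx Hdt Hr Su Sv Hsch HBu HBv x t Hxt.
assert (Ht : 0 < t) by now apply in_box_pos with r x.
assert (HK : 0 < mu / eps + a ^ 2).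
{ assert (0 < mu / eps) by (apply Rdiv_lt_0_compat; lra).
  generalize (pow2_ge_0 a); lra. }
assert (Hc : 0 < char_speed mu a eps) by now apply sqrt_lt_R0.
assert (Edu : forall p q y s, 0 < s -> is_derive (fun y => partial_derive p q u y s) y
  (partial_derive (S p) q u y s)) by (intros; now apply is_derive_partial_x).
assert (Edv : forall p q y s, 0 < s -> is_derive (fun y => partial_derive p q v y s) y
  (partial_derive (S p) q v y s)) by (intros; now apply is_derive_partial_x).
set (c := char_speed mu a eps) in *.
set (K := mu / eps + a ^ 2) in *.
assert (HB0 : 0 <= B).
{ apply Rle_trans with (1 := Rabs_pos (partial_derive 0 0 u x t)).
  apply HBu; [| lia | lia].
  apply in_box_near with x t; trivial; [| lra].
  rewrite Rminus_diag, Rabs_R0; lra. }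
(* Kept for every [y], because the second equation is differentiated in [y] next. *)
assert (Hscheme : forall y,
  u y (t + dt) = u y t - dt / dx * (central_diff dx (fun y => v y t) y
    + c / 8 * second_diff dx (second_diff dx (fun y => u y t)) y) /\
  v y (t + dt) = v y t - dt / dx * (K * central_diff dx (fun y => u y t) y
    + c / 8 * second_diff dx (second_diff dx (fun y => v y t)) y)
    + dt * (/ eps * (burgers_flux (u y (t + dt)) - v y (t + dt)))).
{ intros y; specialize (Hsch y t Ht).
  rewrite upwind_scheme_sample in Hsch by (trivial; lra).
  unfold sample in Hsch; simpl in Hsch; rewrite Rmult_0_l, Rplus_0_r in Hsch.
  now injection Hsch. }
assert (Hu := proj1 (Hscheme x)).
set (p := fun s y => partial_derive 1 0 v y s).
set (ux := fun s y => partial_derive 1 0 u y s).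
(* The [x]-derivative of the second equation. It contains [v] only through [p = v_x] and its
   differences, and the bounds on [v] concern derivatives only. *)
assert (Hv : p (t + dt) x = p t x - dt / dx * (K * central_diff dx (ux t) x
    + c / 8 * second_diff dx (second_diff dx (p t)) x)
    + dt * (/ eps * (u x (t + dt) * ux (t + dt) x - p (t + dt) x))).
{ rewrite <- (is_derive_unique (fun y => v y (t + dt)) x (p (t + dt) x))
    at 1 by (apply (Edv 0%nat 0%nat); lra).
  apply is_derive_unique.
  eapply is_derive_ext; [intros y; symmetry; apply (proj2 (Hscheme y)) |].
  apply (is_derive_plus (fun y => v y t - dt / dx * (K * central_diff dx (fun y => u y t) y
    + c / 8 * second_diff dx (second_diff dx (fun y => v y t)) y))
    (fun y => dt * (/ eps * (burgers_flux (u y (t + dt)) - v y (t + dt))))).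
  - apply (is_derive_minus (fun y => v y t)); [now apply (Edv 0%nat 0%nat) |].
    apply (is_derive_scal (fun y => K * central_diff dx (fun y => u y t) y
      + c / 8 * second_diff dx (second_diff dx (fun y => v y t)) y)).
    apply (is_derive_plus (fun y => K * central_diff dx (fun y => u y t) y)
      (fun y => c / 8 * second_diff dx (second_diff dx (fun y => v y t)) y));
      apply is_derive_scal.
    + apply is_derive_central_diff; intros y; now apply (Edu 0%nat 0%nat).
    + apply is_derive_second_diff; intros y; apply is_derive_second_diff.
      intros z; now apply (Edv 0%nat 0%nat).
  - do 2 apply is_derive_scal.
    apply (is_derive_minus (fun y => burgers_flux (u y (t + dt)))
      (fun y => v y (t + dt))); [| apply (Edv 0%nat 0%nat); lra].
    unfold burgers_flux; evar_last.
    + apply is_derive_scal, is_derive_pow, (Edu 0%nat 0%nat); lra.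
    + simpl; unfold ux; change (partial_derive 0 0 u x (t + dt)) with (u x (t + dt)).
      field. }
assert (Hnear : forall y, Rabs (y - x) <= 2 * dx -> in_box (r + 1) y t).
{ intros y Hy; apply in_box_near with x t; trivial; lra. }
assert (Hlater : forall s, t <= s <= t + dt -> in_box (r + 1) x s).
{ intros s Hs; apply in_box_near with x t; trivial; [| lra].
  rewrite Rminus_diag, Rabs_R0; lra. }
(* First-order Taylor remainder in time: the tangent at [t] is subtracted, and the slope left over
   is at most [B * dt] by the bound on [u_tt]. *)
destruct (exists_remainder (u x (t + dt) - u x t) (partial_derive 0 1 u x t) dt (B * dt))
  as [e1 [E1 B1]]; [lra | |].
{ replace (u x (t + dt) - u x t - dt * partial_derive 0 1 u x t) with
    ((u x (t + dt) - (t + dt - t) * partial_derive 0 1 u x t)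
     - (u x t - (t - t) * partial_derive 0 1 u x t)) by ring.
  replace (dt * (B * dt)) with (B * dt * Rabs (t + dt - t))
    by (rewrite Rabs_pos_eq by lra; ring).
  apply (mvt_bound (fun s => u x s - (s - t) * partial_derive 0 1 u x t)
    (fun s => partial_derive 0 1 u x s - partial_derive 0 1 u x t)).
  rewrite Rmin_left, Rmax_right by lra; intros s Hs; split.
  - apply (is_derive_minus (fun s => u x s)
      (fun s => (s - t) * partial_derive 0 1 u x t)).
    + apply (is_derive_partial_t 0 0); trivial; lra.
    + auto_derive; [trivial | ring].
  - apply Rle_trans with (B * Rabs (s - t)).
    + apply (mvt_bound (fun s => partial_derive 0 1 u x s)
        (fun s => partial_derive 0 2 u x s)).
      rewrite Rmin_left, Rmax_right by lra; intros z Hz; split.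
      * apply is_derive_partial_t; trivial; lra.
      * apply HBu; [apply Hlater; lra | lia | lia].
    + rewrite Rabs_pos_eq by lra; nra. }
destruct (exists_remainder (central_diff dx (fun y => v y t) x) (p t x) dx
  (5 / 2 * dx * B)) as [e2 [E2 B2]]; [lra | |].
{ apply (central_diff_bound (fun y => v y t) (p t) (fun y => partial_derive 2 0 v y t));
    [intros y; now apply (Edv 0%nat 0%nat) | intros y; now apply Edv | lra |].
  intros y Hy; apply HBv; auto; lia. }
(* The scale [dx ^ 4] with target 0: after division by [dx] this leaves the [dx ^ 3] of the
   numerical viscosity. *)
destruct (exists_remainder (second_diff dx (second_diff dx (fun y => u y t)) x) 0
  (dx ^ 4) (4 * B)) as [e3 [E3 B3]]; [apply pow_lt; lra | |].
{ rewrite Rmult_0_r, Rminus_0_r.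
  replace (dx ^ 4 * (4 * B)) with (4 * dx ^ 4 * B) by ring.
  apply (fourth_diff_bound (fun y => u y t) (ux t) (fun y => partial_derive 2 0 u y t)
    (fun y => partial_derive 3 0 u y t) (fun y => partial_derive 4 0 u y t));
    [intros y; now apply (Edu 0%nat 0%nat) | intros y; now apply Edu
    | intros y; now apply Edu | intros y; now apply Edu | lra |].
  intros y Hy; apply HBu; auto; lia. }
destruct (increment_remainder (fun s => p s x) (fun s => partial_derive 1 1 v x s)
  t dt B) as [e4 [E4 B4]]; [lra | |].
{ intros s Hs; split; [apply is_derive_partial_t; trivial; lra |].
  apply HBv; [now apply Hlater | lia | lia | lia]. }
destruct (exists_remainder (central_diff dx (ux t) x) (partial_derive 2 0 u x t) dx
  (5 / 2 * dx * B)) as [e5 [E5 B5]]; [lra | |].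
{ apply (central_diff_bound (ux t) (fun y => partial_derive 2 0 u y t)
    (fun y => partial_derive 3 0 u y t));
    [intros y; now apply Edu | intros y; now apply Edu | lra |].
  intros y Hy; apply HBu; auto; lia. }
(* The fourth difference of [v_x] is the place where the fifth space derivative of [v] enters. *)
destruct (exists_remainder (second_diff dx (second_diff dx (p t)) x) 0
  (dx ^ 4) (4 * B)) as [e6 [E6 B6]]; [apply pow_lt; lra | |].
{ rewrite Rmult_0_r, Rminus_0_r.
  replace (dx ^ 4 * (4 * B)) with (4 * dx ^ 4 * B) by ring.
  apply (fourth_diff_bound (p t) (fun y => partial_derive 2 0 v y t)
    (fun y => partial_derive 3 0 v y t) (fun y => partial_derive 4 0 v y t)
    (fun y => partial_derive 5 0 v y t));
    [intros y; now apply Edv | intros y; now apply Edv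
    | intros y; now apply Edv | intros y; now apply Edv | lra |].
  intros y Hy; apply HBv; auto; lia. }
(* The relaxation source is implicit, so [u * u_x] has to be moved from [t + dt] back to [t]. *)
destruct (increment_remainder (fun s => u x s * ux s x)
  (fun s => partial_derive 0 1 u x s * ux s x + u x s * partial_derive 1 1 u x s)
  t dt (2 * B ^ 2)) as [e7 [E7 B7]]; [lra | |].
{ intros s Hs; split.
  - apply (is_derive_mult (fun s => u x s) (fun s => ux s x));
      [| | intros; apply Rmult_comm].
    + apply (is_derive_partial_t 0 0); trivial; lra.
    + apply is_derive_partial_t; trivial; lra.
  - assert (Q := fun m k Hm Hk => HBu x s (Hlater s Hs) m k Hm Hk).
    apply Rle_trans with (1 := Rabs_triang _ _); rewrite !Rabs_mult.
    replace (2 * B ^ 2) with (B * B + B * B) by ring.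
    apply Rplus_le_compat; apply Rmult_le_compat; try apply Rabs_pos;
      try (apply Q; lia).
    apply (Q 0%nat 0%nat); lia. }
assert (B8 : Rabs (partial_derive 2 0 u x t) <= B).
{ apply HBu; [apply Hlater; lra | lia | lia]. }
rewrite viscous_residual_burgers by assumption.
change (partial_derive 1 0 u x t) with (ux t x).
set (ut := partial_derive 0 1 u x t) in *.
set (uxx := partial_derive 2 0 u x t) in *.
(* The first equation divided by [dt] and solved for [u_t]. *)
assert (EA : ut = - e1 - (p t x + e2) - c / 8 * dx ^ 3 * e3).
{ apply (Rmult_eq_reg_l dt); [| lra].
  assert (E : u x (t + dt) - u x t = dt * (ut + e1)) by exact E1.
  rewrite E2, E3, Rplus_0_l in Hu.
  replace (dt / dx * (dx * (p t x + e2) + c / 8 * (dx ^ 4 * e3)))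
    with (dt * (p t x + e2) + dt * (c / 8 * dx ^ 3 * e3)) in Hu by (field; lra).
  lra. }
(* The differentiated second equation multiplied by [eps / dt] and solved for [v_x];
   [eps * K = mu + eps * a ^ 2] brings out the viscosity [mu]. *)
assert (EB : p t x = u x t * ux t x + dt * e7 - dt * e4 - eps * e4
  - (mu + eps * a ^ 2) * (uxx + e5) - eps * (c / 8) * dx ^ 3 * e6).
{ apply (Rmult_eq_reg_l (dt / eps));
    [| apply Rgt_not_eq, Rdiv_lt_0_compat; lra].
  rewrite E5, E6, Rplus_0_l in Hv.
  replace (u x (t + dt) * ux (t + dt) x) with (u x t * ux t x + dt * e7) in Hv by lra.
  replace (p (t + dt) x) with (p t x + dt * e4) in Hv by lra.
  replace (dt / dx * (K * (dx * (uxx + e5)) + c / 8 * (dx ^ 4 * e6)))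
    with (dt * (K * (uxx + e5)) + dt * (c / 8 * dx ^ 3 * e6)) in Hv by (field; lra).
  replace (mu + eps * a ^ 2) with (eps * K) by (unfold K; field; lra).
  apply (Rplus_eq_reg_l (dt * e4)).
  replace (dt / eps * (u x t * ux t x + dt * e7 - dt * e4 - eps * e4
    - eps * K * (uxx + e5) - eps * (c / 8) * dx ^ 3 * e6)) with
    (dt * (/ eps * (u x t * ux t x + dt * e7 - dt * e4)) - dt * e4
     - dt * (K * (uxx + e5)) - dt * (c / 8 * dx ^ 3 * e6)) by (field; lra).
  replace (dt / eps * p t x) with (dt * (/ eps * p t x)) by (field; lra).
  lra. }
(* Eliminating [v_x] cancels [u * u_x] and [mu * u_xx]; only remainder terms survive. *)
replace (ut + u x t * ux t x - mu * uxx) with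
  (- e1 - e2 - c / 8 * dx ^ 3 * e3 + dt * (e4 - e7) + eps * (e4 + a ^ 2 * uxx)
   + (mu + eps * a ^ 2) * e5 + eps * (c / 8 * dx ^ 3 * e6))
  by (rewrite EA, EB; ring).
set (N := c * dx ^ 3).
assert (HN : 0 < N) by (apply Rmult_lt_0_compat; [| apply pow_lt]; lra).
replace (c / 8 * dx ^ 3 * e3) with (N * (e3 / 8)) by (unfold N; field).
replace (c / 8 * dx ^ 3 * e6) with (N * (e6 / 8)) by (unfold N; field).
clear - B1 B2 B3 B4 B5 B6 B7 B8 HN HB0 Hmu Heps Hdx Hdt.
assert (Ha := pow2_ge_0 a).
assert (scaled : forall q X b, 0 <= q -> Rabs X <= b -> Rabs (q * X) <= q * b).
{ intros q X b Hq HX; rewrite Rabs_mult, (Rabs_pos_eq q) by assumption.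
  now apply Rmult_le_compat_l. }
assert (D3 := scaled N (e3 / 8) (B / 2) (Rlt_le _ _ HN)
  ltac:(apply Rabs_le_between in B3, B6; apply Rabs_le_between; lra)).
assert (D6 := scaled N (e6 / 8) (B / 2) (Rlt_le _ _ HN)
  ltac:(apply Rabs_le_between in B3, B6; apply Rabs_le_between; lra)).
assert (D6' := scaled eps _ _ ltac:(lra) D6).
assert (D4 := scaled dt (e4 - e7) (B + 2 * B ^ 2) ltac:(lra)
  ltac:(apply Rabs_le_between in B4, B7; apply Rabs_le_between; lra)).
assert (D8 := scaled (a ^ 2) uxx B Ha B8).
assert (D9 := scaled eps (e4 + a ^ 2 * uxx) (B + a ^ 2 * B) ltac:(lra)
  ltac:(apply Rle_trans with (1 := Rabs_triang _ _); lra)).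
assert (D5 := scaled (mu + eps * a ^ 2) e5 (5 / 2 * dx * B) ltac:(nra) B5).
assert (Q1 : eps * (N * (B / 2)) <= N * (B / 2)).
{ assert (0 <= N * (B / 2)) by (apply Rmult_le_pos; lra). nra. }
assert (Q2 : (mu + eps * a ^ 2) * (5 / 2 * dx * B) <= 5 / 2 * ((mu + a ^ 2) * (dx * B))).
{ assert (0 <= dx * B) by nra. assert (eps * a ^ 2 <= a ^ 2) by nra. nra. }
apply Rle_trans with (B * dt + 5 / 2 * dx * B + N * (B / 2) + dt * (B + 2 * B ^ 2)
  + eps * (B + a ^ 2 * B) + 5 / 2 * ((mu + a ^ 2) * (dx * B)) + N * (B / 2)).
{ revert B1 B2 D3 D4 D9 D5 D6' Q1 Q2; clear.
  generalize (N * (e3 / 8)) (dt * (e4 - e7)) (eps * (e4 + a ^ 2 * uxx))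
    ((mu + eps * a ^ 2) * e5) (eps * (N * (e6 / 8))).
  intros r1 r2 r3 r4 r5 B1 B2 D3 D4 D9 D5 D6' Q1 Q2; apply Rabs_le_between in B1, B2, D3, D4, D9, D5, D6'.
  apply Rabs_le_between; lra. }
(* Once the signs of all products are known, comparing the coefficients of [dx], [dt], [eps] and [N]
   is linear arithmetic. *)
assert (P1 : 0 <= B * dx) by nra.
assert (P2 : 0 <= B * dt) by nra.
assert (P3 : 0 <= B * eps) by nra.
assert (P4 : 0 <= B * N) by nra.
assert (P5 : 0 <= mu + a ^ 2) by lra.
generalize (Rmult_le_pos _ _ P1 HB0) (Rmult_le_pos _ _ P2 HB0)
  (Rmult_le_pos _ _ P3 HB0) (Rmult_le_pos _ _ P4 HB0)
  (Rmult_le_pos _ _ P1 Ha) (Rmult_le_pos _ _ P2 Ha)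
  (Rmult_le_pos _ _ P3 Ha) (Rmult_le_pos _ _ P4 Ha)
  (Rmult_le_pos _ _ P1 P5) (Rmult_le_pos _ _ P2 P5)
  (Rmult_le_pos _ _ P3 P5) (Rmult_le_pos _ _ P4 P5).
revert P1 P2 P3 P4; clear; generalize (mu + a ^ 2); intros; lra.
Qed.

(** * Orders of magnitude as [eps] tends to 0 from the right *)

Lemma Rpower_vanishes (p eta : R) :
  0 < p -> 0 < eta -> at_right 0 (fun eps => Rpower eps p <= eta).
Proof.
intros Hp Heta.
(* The radius is [Rpower eta (/ p)] unfolded, whose [p]-th power is [eta]. *)
exists (mkposreal _ (exp_pos (/ p * ln eta))); simpl; intros eps Heps Hpos.
replace eta with (Rpower (Rpower eta (/ p)) p)
  by (rewrite Rpower_mult, Rinv_l, Rpower_1 by lra; trivial).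
apply Rle_Rpower_l; [lra | split; trivial].
assert (H : Rabs (eps - 0) < Rpower eta (/ p)) by exact Heps.
apply Rabs_def2 in H; lra.
Qed.

Lemma at_right_pos : at_right 0 (fun eps => 0 < eps).
Proof. exists (mkposreal 1 Rlt_0_1); trivial. Qed.

Lemma at_right_le_1 : at_right 0 (fun eps => eps <= 1).
Proof.
exists (mkposreal 1 Rlt_0_1); intros eps Heps _.
assert (H : Rabs (eps - 0) < 1) by exact Heps.
apply Rabs_def2 in H; lra.
Qed.

(** Since [eps^p = eps^(p-q) * eps^q], the first factor can be made smaller than any prescribed
    multiple. [Rabs C + 1] is a positive majorant of the constant, whose sign is unknown. *)
Lemma big_O_is_domin (p q : R) (h : R -> R) :
  q < p -> big_O (fun eps => Rpower eps p) h ->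
  is_domin (at_right 0) (fun eps => Rpower eps q) h.
Proof.
intros Hpq [C HC] eta.
assert (HC0 : 0 < Rabs C + 1) by (generalize (Rabs_pos C); lra).
assert (Hr : 0 < eta / (Rabs C + 1)) by (apply Rdiv_lt_0_compat; [apply cond_pos | trivial]).
generalize (filter_and _ _ HC (Rpower_vanishes (p - q) _ ltac:(lra) Hr)).
apply filter_imp; intros eps [H1 H2].
change (Rabs (h eps) <= eta * Rabs (Rpower eps q)).
assert (P : forall y, 0 < Rpower eps y) by (intros; apply exp_pos).
rewrite (Rabs_pos_eq (Rpower eps p)) in H1 by apply Rlt_le, P.
rewrite (Rabs_pos_eq (Rpower eps q)) by apply Rlt_le, P.
apply Rle_trans with (1 := H1).
replace p with ((p - q) + q) by ring.
rewrite Rpower_plus, <- Rmult_assoc.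
apply Rmult_le_compat_r; [apply Rlt_le, P |].
apply Rle_trans with ((Rabs C + 1) * Rpower eps (p - q)).
- apply Rmult_le_compat_r; [apply Rlt_le, P | generalize (Rle_abs C); lra].
- replace (pos eta) with ((Rabs C + 1) * (eta / (Rabs C + 1))) by (field; lra).
  apply Rmult_le_compat_l; lra.
Qed.

Lemma big_O_vanishes (p : R) (h : R -> R) (eta : R) :
  0 < p -> big_O (fun eps => Rpower eps p) h -> 0 < eta ->
  at_right 0 (fun eps => Rabs (h eps) <= eta).
Proof.
intros Hp Hh Heta.
generalize (filter_and _ _ at_right_pos
  (big_O_is_domin p 0 h Hp Hh (mkposreal eta Heta))).
apply filter_imp; intros eps [Hpos H].
change (Rabs (h eps) <= eta * Rabs (Rpower eps 0)) in H.
rewrite Rpower_O, Rabs_R1 in H by assumption; lra.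
Qed.

Lemma big_O_mult (p q : R) (g h : R -> R) :
  big_O (fun eps => Rpower eps p) g -> big_O (fun eps => Rpower eps q) h ->
  big_O (fun eps => Rpower eps (p + q)) (fun eps => g eps * h eps).
Proof.
intros [C HC] [C' HC']; exists (C * C').
generalize (filter_and _ _ HC HC'); apply filter_imp; intros eps [H1 H2].
rewrite Rpower_plus, !Rabs_mult.
replace (C * C' * (Rabs (Rpower eps p) * Rabs (Rpower eps q)))
  with ((C * Rabs (Rpower eps p)) * (C' * Rabs (Rpower eps q))) by ring.
apply Rmult_le_compat; trivial; apply Rabs_pos.
Qed.

(** For [eps <= 1] one has [mu / eps + a ^ 2 <= (mu + a ^ 2) / eps]. *)
Lemma big_O_char_speed (mu a : R) :
  0 < mu -> big_O (fun eps => Rpower eps (- / 2)) (char_speed mu a).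
Proof.
intros Hmu; exists (sqrt (mu + a ^ 2)).
generalize (filter_and _ _ at_right_pos at_right_le_1); apply filter_imp.
intros eps [H1 H2]; unfold char_speed.
assert (Ha := pow2_ge_0 a).
rewrite (Rabs_pos_eq (sqrt _)) by apply sqrt_pos.
rewrite Rabs_pos_eq by apply Rlt_le, exp_pos.
rewrite Rpower_Ropp, Rpower_sqrt, <- sqrt_inv, <- sqrt_mult_alt by lra.
apply sqrt_le_1_alt.
replace ((mu + a ^ 2) * / eps) with (mu / eps + a ^ 2 * / eps) by (field; lra).
apply Rplus_le_compat_l.
assert (1 <= / eps) by (rewrite <- Rinv_1; apply Rinv_le_contravar; lra).
nra.
Qed.

(** * Uniform bounds and consequences of the expansion *)

(** Finitely many constants merge into their maximum and finitely many ranges of [eps] into their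
    intersection. It serves to have a single bound for all the derivatives in the estimate. *)
Lemma finite_uniform_bound (Q : nat -> R -> R -> Prop) (N : nat) :
  (forall i C C' eps, C <= C' -> Q i C eps -> Q i C' eps) ->
  (forall i, exists C, at_right 0 (Q i C)) ->
  exists C, at_right 0 (fun eps => forall i, (i <= N)%nat -> Q i C eps).
Proof.
intros Hmono HQ; induction N as [|N [C HC]].
- destruct (HQ 0%nat) as [C HC]; exists C; revert HC; apply filter_imp.
  intros eps H i Hi; now replace i with 0%nat by lia.
- destruct (HQ (S N)) as [C' HC']; exists (Rmax C C').
  generalize (filter_and _ _ HC HC'); apply filter_imp; intros eps [H1 H2] i Hi.
  destruct (Nat.eq_dec i (S N)) as [-> | Hne].
  + apply Hmono with (2 := H2), Rmax_r.
  + apply Hmono with C; [apply Rmax_l | apply H1; lia].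
Qed.

Lemma locally_bounded_uniformly (g : nat -> nat -> R -> R -> R -> R) (N : nat) (r : R) :
  0 < r -> (forall m k, locally_bounded_in_eps (g m k)) ->
  exists B, at_right 0 (fun eps => forall x t, in_box r x t ->
    forall m k, (m <= N)%nat -> (k <= N)%nat -> Rabs (g m k eps x t) <= B).
Proof.
intros Hr Hg.
destruct (finite_uniform_bound (fun m C eps => forall k, (k <= N)%nat ->
  forall x t, in_box r x t -> Rabs (g m k eps x t) <= C) N) as [B HB].
- intros m C C' eps HC H k Hk x t Hxt.
  apply Rle_trans with C; [now apply H | assumption].
- intros m; apply finite_uniform_bound with
    (Q := fun k C eps => forall x t, in_box r x t -> Rabs (g m k eps x t) <= C).
  + intros k C C' eps HC H x t Hxt.
    apply Rle_trans with C; [now apply H | assumption].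
  + intros k; now apply Hg.
- exists B; revert HB; apply filter_imp; intros eps H x t Hxt m k Hm Hk.
  now apply H.
Qed.

(** The quotient equals the derivative of [u1] plus [eps] times the scaled remainder, both bounded
    when [eps <= 1]. *)
Lemma has_expansion_close (u u0 u1 : R -> R -> R -> R) (m k : nat) :
  has_expansion u u0 u1 ->
  locally_bounded_in_eps (fun eps x t =>
    (partial_derive m k (u eps) x t - partial_derive m k (u0 eps) x t) / eps).
Proof.
intros [_ H] r Hr.
destruct (H m k) as [_ [H1 H2]].
destruct (H1 r Hr) as [C1 HC1], (H2 r Hr) as [C2 HC2]; exists (C1 + C2).
generalize (filter_and _ _ (filter_and _ _ at_right_pos at_right_le_1)
  (filter_and _ _ HC1 HC2)).
apply filter_imp; intros eps [[Hpos Hle] [K1 K2]] x t Hxt.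
specialize (K1 x t Hxt); specialize (K2 x t Hxt).
revert K1 K2; set (d := partial_derive m k (u eps) x t).
set (d0 := partial_derive m k (u0 eps) x t).
set (d1 := partial_derive m k (u1 eps) x t); intros K1 K2.
replace ((d - d0) / eps) with (d1 + eps * ((d - (d0 + eps * d1)) / eps ^ 2))
  by (field; lra).
apply Rle_trans with (1 := Rabs_triang _ _); apply Rplus_le_compat; trivial.
rewrite Rabs_mult, (Rabs_pos_eq eps) by lra.
generalize (Rabs_pos ((d - (d0 + eps * d1)) / eps ^ 2)); nra.
Qed.

(** For [m = k = 0] this is the bound on [u] itself, obtained from [u0] and the [O(eps)] distance to
    it. *)
Lemma has_expansion_bounded (u u0 u1 : R -> R -> R -> R) (m k : nat) :
  has_expansion u u0 u1 ->
  locally_bounded_in_eps (fun eps => partial_derive m k (u eps)).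
Proof.
intros H r Hr.
destruct (proj2 H m k) as [H0 _].
destruct (H0 r Hr) as [C0 HC0], (has_expansion_close _ _ _ m k H r Hr) as [C HC].
exists (C0 + C).
generalize (filter_and _ _ (filter_and _ _ at_right_pos at_right_le_1)
  (filter_and _ _ HC0 HC)).
apply filter_imp; intros eps [[Hpos Hle] [K1 K2]] x t Hxt.
specialize (K1 x t Hxt); specialize (K2 x t Hxt).
revert K1 K2; set (d := partial_derive m k (u eps) x t).
set (d0 := partial_derive m k (u0 eps) x t); intros K1 K2.
replace d with (d0 + eps * ((d - d0) / eps)) by (field; lra).
apply Rle_trans with (1 := Rabs_triang _ _); apply Rplus_le_compat; trivial.
rewrite Rabs_mult, (Rabs_pos_eq eps) by lra.
generalize (Rabs_pos ((d - d0) / eps)); nra.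
Qed.

(** * From the numerical solution to its leading-order term *)

(** The nonlinear difference splits as [u * (u_x - w_x) + w_x * (u - w)]; its two terms give
    [2 * B], while [u_t] and [mu * u_xx] give 1 and [mu]. *)
Lemma viscous_residual_close (mu delta B x t : R) (u w : R -> R -> R) :
  0 <= mu -> smooth u -> smooth w -> 0 < t ->
  (forall m k, (m <= 2)%nat -> (k <= 2)%nat ->
     Rabs (partial_derive m k u x t - partial_derive m k w x t) <= delta) ->
  Rabs (u x t) <= B -> Rabs (partial_derive 1 0 w x t) <= B ->
  Rabs (viscous_residual burgers_flux mu w x t)
  <= Rabs (viscous_residual burgers_flux mu u x t) + (1 + 2 * B + mu) * delta.
Proof.
intros Hmu Su Sw Ht Hd Hu Hw.
rewrite !viscous_residual_burgers by assumption.
assert (D00 := Hd 0%nat 0%nat ltac:(lia) ltac:(lia)).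
change (Rabs (u x t - w x t) <= delta) in D00.
assert (D01 := Hd 0%nat 1%nat ltac:(lia) ltac:(lia)).
assert (D10 := Hd 1%nat 0%nat ltac:(lia) ltac:(lia)).
assert (D20 := Hd 2%nat 0%nat ltac:(lia) ltac:(lia)).
revert D00 D01 D10 D20 Hu Hw; clear - Hmu.
generalize (u x t) (w x t) (partial_derive 0 1 u x t) (partial_derive 0 1 w x t)
  (partial_derive 1 0 u x t) (partial_derive 1 0 w x t)
  (partial_derive 2 0 u x t) (partial_derive 2 0 w x t).
intros u0 w0 ut wt ux wx uxx wxx D00 D01 D10 D20 Hu Hw.
replace (wt + w0 * wx - mu * wxx) with ((ut + u0 * ux - mu * uxx)
  + (- (ut - wt) + (- (u0 * (ux - wx)) + (- (wx * (u0 - w0)) + mu * (uxx - wxx)))))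
  by ring.
apply Rle_trans with (1 := Rabs_triang _ _), Rplus_le_compat_l.
replace ((1 + 2 * B + mu) * delta) with
  (delta + (B * delta + (B * delta + mu * delta))) by ring.
apply Rle_trans with (1 := Rabs_triang _ _); rewrite Rabs_Ropp.
apply Rplus_le_compat; trivial.
apply Rle_trans with (1 := Rabs_triang _ _); rewrite Rabs_Ropp, Rabs_mult.
apply Rplus_le_compat; [apply Rmult_le_compat; trivial; apply Rabs_pos |].
apply Rle_trans with (1 := Rabs_triang _ _); rewrite Rabs_Ropp, !Rabs_mult.
rewrite (Rabs_pos_eq mu) by assumption.
apply Rplus_le_compat; [| now apply Rmult_le_compat_l].
apply Rmult_le_compat; trivial; apply Rabs_pos.
Qed.

(** The residual of [u] is small by the modified equation estimate, and [u0] is [O(eps)] close to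
    [u] together with its derivatives, so the smallness passes to [u0] uniformly on the box. *)
Lemma upwind_leading_order (mu a : R) (D : R -> Prop) (dx dt : R -> R)
    (u v u0 u1 : R -> R -> R -> R) (r eta : R) :
  0 < mu ->
  at_right 0 (fun eps => 0 < dx eps /\ 0 < dt eps) ->
  (forall theta, 0 < theta -> at_right 0 (fun eps =>
     dx eps + dt eps + eps + char_speed mu a eps * dx eps ^ 3 <= theta)) ->
  at_right 0 (fun eps =>
    smooth (u eps) /\ smooth (v eps) /\
    (forall x t, 0 < t -> D (u eps x t)) /\
    satisfies_scheme (upwind_scheme burgers_flux mu a) eps (dx eps) (dt eps)
      (u eps) (v eps)) ->
  (forall m k : nat, (0 < m + k)%nat ->
    locally_bounded_in_eps (fun eps => partial_derive m k (v eps))) ->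
  has_expansion u u0 u1 -> 0 < r -> 0 < eta ->
  at_right 0 (fun eps => forall x t, in_box r x t ->
    Rabs (viscous_residual burgers_flux mu (u0 eps) x t) <= eta).
Proof.
intros Hmu Hpos Herr Hsol Hv Hexp Hr Heta.
assert (Hr1 : 0 < r + 1) by lra.
destruct (locally_bounded_uniformly (fun m k eps => partial_derive m k (u eps)) 5
  (r + 1) Hr1 (fun m k => has_expansion_bounded u u0 u1 m k Hexp)) as [B1 HB1].
(* The index [(0, 0)] is filled with the zero function, as only derivatives of [v] are bounded. *)
destruct (locally_bounded_uniformly (fun m k eps =>
  if (m + k =? 0)%nat then (fun _ _ => 0) else partial_derive m k (v eps)) 5
  (r + 1) Hr1) as [B2 HB2].
{ intros m k; destruct (Nat.eqb_spec (m + k) 0).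
  - intros r' _; exists 0; apply filter_forall; intros; rewrite Rabs_R0; lra.
  - apply Hv; lia. }
destruct (locally_bounded_uniformly (fun m k eps => partial_derive m k (u0 eps)) 5
  r Hr (fun m k => proj1 (proj2 Hexp m k))) as [B3 HB3].
destruct (locally_bounded_uniformly (fun m k eps x t =>
  (partial_derive m k (u eps) x t - partial_derive m k (u0 eps) x t) / eps) 5
  r Hr (fun m k => has_expansion_close u u0 u1 m k Hexp)) as [C HC].
set (B := Rabs B1 + Rabs B2 + Rabs B3).
assert (HB : B1 <= B /\ B2 <= B /\ B3 <= B).
{ unfold B; generalize (Rle_abs B1) (Rle_abs B2) (Rle_abs B3)
    (Rabs_pos B1) (Rabs_pos B2) (Rabs_pos B3); lra. }
assert (HB0 : 0 <= B).
{ unfold B; generalize (Rabs_pos B1) (Rabs_pos B2) (Rabs_pos B3); lra. }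
set (L := B * (6 + 2 * B + a ^ 2 + 3 * (mu + a ^ 2)) + (1 + 2 * B + mu) * Rabs C).
assert (HL : 0 <= L).
{ apply Rplus_le_le_0_compat; apply Rmult_le_pos; try apply Rabs_pos; trivial;
    generalize (pow2_ge_0 a); lra. }
(* The first entry enforces the smallness of [dx], [dt] and [eps] required by the estimate; the
   second yields [L * err <= eta], with [L + 1] because [L] may vanish. *)
assert (Htheta : 0 < Rmin (1 / 2) (eta / (L + 1))).
{ apply Rmin_glb_lt; [lra | apply Rdiv_lt_0_compat; lra]. }
generalize (filter_and _ _ (filter_and _ _ HB1 HB2) (filter_and _ _ (filter_and _ _ HB3 HC)
  (filter_and _ _ (filter_and _ _ at_right_pos Hpos) (filter_and _ _ (Herr _ Htheta)
  (filter_and _ _ Hsol (proj1 Hexp)))))).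
apply filter_imp; clear HB1 HB2 HB3 HC Hpos Herr Hsol Hexp.
intros eps [[HB1 HB2] [[HB3 HC] [[Heps [Hdx Hdt]] [Herr
  [[Su [Sv [_ Hsch]]] [Su0 _]]]]]] x t Hxt.
set (err := dx eps + dt eps + eps + char_speed mu a eps * dx eps ^ 3) in *.
assert (HN : 0 <= char_speed mu a eps * dx eps ^ 3).
{ apply Rmult_le_pos; [apply sqrt_pos | apply pow_le; lra]. }
assert (Herr1 := Rle_trans _ _ _ Herr (Rmin_l _ _)).
assert (Herr2 := Rle_trans _ _ _ Herr (Rmin_r _ _)).
assert (Hres : Rabs (viscous_residual burgers_flux mu (u eps) x t)
  <= B * (6 + 2 * B + a ^ 2 + 3 * (mu + a ^ 2)) * err).
{ apply modified_equation_estimate with r (v eps); unfold err in *; trivial; try lra.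
  - intros y s Hys m k Hm Hk; apply Rle_trans with B1; [now apply HB1 | apply HB].
  - intros y s Hys m k Hm Hk Hmk; apply Rle_trans with B2; [| apply HB].
    specialize (HB2 y s Hys m k Hm Hk); revert HB2.
    destruct (Nat.eqb_spec (m + k) 0); [lia | trivial]. }
assert (Hclose : Rabs (viscous_residual burgers_flux mu (u0 eps) x t)
  <= Rabs (viscous_residual burgers_flux mu (u eps) x t)
     + (1 + 2 * B + mu) * (Rabs C * eps)).
{ apply viscous_residual_close; trivial.
  - lra.
  - now apply in_box_pos with r x.
  - intros m k Hm Hk.
    specialize (HC x t Hxt m k ltac:(lia) ltac:(lia)).
    revert HC; generalize (partial_derive m k (u eps) x t - partial_derive m k (u0 eps) x t).
    intros d HC.
    replace d with (d / eps * eps) by (field; lra).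
    rewrite Rabs_mult, (Rabs_pos_eq eps) by lra.
    apply Rmult_le_compat_r; [lra |].
    apply Rle_trans with (1 := HC), Rle_abs.
  - apply Rle_trans with B1; [| apply HB].
    apply (HB1 x t) with (m := 0%nat) (k := 0%nat); [| lia | lia].
    apply in_box_near with x t; trivial; [| lra].
    rewrite Rminus_diag, Rabs_R0; lra.
  - apply Rle_trans with B3; [| apply HB].
    apply HB3; trivial; lia. }
apply Rle_trans with (L * err).
- apply Rle_trans with (1 := Hclose).
  replace (L * err) with (B * (6 + 2 * B + a ^ 2 + 3 * (mu + a ^ 2)) * err
    + (1 + 2 * B + mu) * (Rabs C * err)) by (unfold L; ring).
  apply Rplus_le_compat; trivial.
  apply Rmult_le_compat_l; [lra |].
  apply Rmult_le_compat_l; [apply Rabs_pos | unfold err; lra].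
- apply Rle_trans with (L * (eta / (L + 1))); [now apply Rmult_le_compat_l |].
  apply Rmult_le_reg_r with (L + 1); [lra |].
  replace (L * (eta / (L + 1)) * (L + 1)) with (L * eta) by (field; lra).
  nra.
Qed.

(** Coefficients free of [eps] form a constant family; their residual does not depend on [eps] and
    lies below every [eta], hence it is 0. *)
Lemma upwind_converges_to_viscous (mu a : R) (D : R -> Prop) (dx dt : R -> R) :
  0 < mu ->
  at_right 0 (fun eps => 0 < dx eps /\ 0 < dt eps) ->
  (forall theta, 0 < theta -> at_right 0 (fun eps =>
     dx eps + dt eps + eps + char_speed mu a eps * dx eps ^ 3 <= theta)) ->
  converges_to_viscous burgers_flux mu D (upwind_scheme burgers_flux mu a) dx dt.
Proof.
intros Hmu Hpos Herr u v Hsol Hbd; split.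
- intros w0 w1 Hexp x t Ht.
  (* A radius that puts the given point in the box: it dominates [Rabs x], [t] and [/ t]. *)
  set (r := Rabs x + t + / t).
  assert (Hit : 0 < / t) by now apply Rinv_0_lt_compat.
  assert (Hx := Rabs_pos x).
  assert (Hr : 0 < r) by (unfold r; lra).
  assert (Hbox : in_box r x t).
  { split; [unfold r; lra | split; [| unfold r; lra]].
    rewrite <- (Rinv_inv t); apply Rinv_le_contravar; [trivial | unfold r; lra]. }
  assert (Hsmall : forall eta, 0 < eta ->
    Rabs (viscous_residual burgers_flux mu w0 x t) <= eta).
  { intros eta Heta.
    assert (H := upwind_leading_order mu a D dx dt u v (fun _ => w0) (fun _ => w1) r eta
      Hmu Hpos Herr Hsol (fun m k Hmk => proj2 (Hbd m k Hmk)) Hexp Hr Heta).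
    (* A property that holds eventually holds for some [eps], and one is enough here. *)
    destruct (filter_ex _ H) as [eps Heps]; now apply Heps. }
  apply Rabs_eq_0, Rle_antisym, Rabs_pos.
  apply le_epsilon; intros eta Heta; rewrite Rplus_0_l; now apply Hsmall.
- intros u0 u1 Hexp r eta Hr Heta.
  apply upwind_leading_order with a D dx dt u v u1; trivial.
  intros m k Hmk; now apply Hbd.
Qed.

(** * Consistency for fixed [eps] *)

Lemma filterlim_linear {T : Type} (F : (T -> Prop) -> Prop) {FF : Filter F}
    (f g : T -> R) (c d l m : R) :
  filterlim f F (locally l) -> filterlim g F (locally m) ->
  filterlim (fun h => c * f h + d * g h) F (locally (c * l + d * m)).
Proof.
intros Hf Hg.
apply (filterlim_comp_2 (G := locally (c * l)) (H := locally (d * m))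
  (fun h => c * f h) (fun h => d * g h) Rplus).
- apply filterlim_comp with (1 := Hf); apply (filterlim_scal_r c l).
- apply filterlim_comp with (1 := Hg); apply (filterlim_scal_r d m).
- apply (filterlim_plus (c * l) (d * m)).
Qed.

(** The factor [k] is the offset of a stencil point, so one limit covers every point of the stencil
    as well as the time step. *)
Lemma filterlim_diff_quotient (g : R -> R) (x l k : R) :
  is_derive g x l ->
  filterlim (fun h => (g (x + k * h) - g x) / h) (at_right 0) (locally (k * l)).
Proof.
intros Hg.
assert (H : is_derive (fun h => g (x + k * h)) 0 (k * l)).
{ apply (is_derive_comp g (fun h => x + k * h)).
  - now rewrite Rmult_0_r, Rplus_0_r.
  - auto_derive; [trivial | ring]. }
apply is_derive_Reals in H.
apply filterlim_locally; intros eta.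
destruct (H eta (cond_pos eta)) as [delta Hdelta].
exists delta; intros h Hh Hpos.
assert (Hh' : Rabs (h - 0) < delta) by exact Hh.
rewrite Rminus_0_r in Hh'.
specialize (Hdelta h ltac:(lra) Hh').
now rewrite Rplus_0_l, Rmult_0_r, Rplus_0_r in Hdelta.
Qed.

Lemma filterlim_central_diff (g : R -> R) (x l : R) :
  is_derive g x l ->
  filterlim (fun h => central_diff h g x / h) (at_right 0) (locally l).
Proof.
intros Hg.
assert (Q := fun k => filterlim_diff_quotient g x l k Hg).
(* The limit is written with the stencil weights: they sum to 0, so the terms [g x] cancel, and
   their first moment is 1. *)
replace l with (1 * (3 / 4 * (1 * l) + - (3 / 4) * (-1 * l))
  + 1 * (- / 8 * (2 * l) + / 8 * (-2 * l))) by field.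
eapply filterlim_ext;
  [| exact (filterlim_linear _ _ _ 1 1 _ _
      (filterlim_linear _ _ _ (3 / 4) (- (3 / 4)) _ _ (Q 1) (Q (-1)))
      (filterlim_linear _ _ _ (- / 8) (/ 8) _ _ (Q 2) (Q (-2))))].
intros h; simpl; unfold central_diff, Rdiv.
replace (x + 1 * h) with (x + h) by ring.
replace (x + -1 * h) with (x - h) by ring.
replace (x + -2 * h) with (x - 2 * h) by ring.
generalize (/ h); intros; field.
Qed.

(** The weights 1, -4, 6, -4, 1 have zero sum and zero first moment, so one derivative at [x]
    already makes the quotient vanish. *)
Lemma filterlim_fourth_diff (g : R -> R) (x : R) :
  ex_derive g x ->
  filterlim (fun h => second_diff h (second_diff h g) x / h) (at_right 0) (locally 0).
Proof.
intros [l Hg].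
assert (Q := fun k => filterlim_diff_quotient g x l k Hg).
replace 0 with (1 * (-4 * (1 * l) + -4 * (-1 * l))
  + 1 * (1 * (2 * l) + 1 * (-2 * l))) at 2 by ring.
eapply filterlim_ext;
  [| exact (filterlim_linear _ _ _ 1 1 _ _
      (filterlim_linear _ _ _ (-4) (-4) _ _ (Q 1) (Q (-1)))
      (filterlim_linear _ _ _ 1 1 _ _ (Q 2) (Q (-2))))].
intros h; simpl; unfold second_diff, Rdiv.
replace (x + h + h) with (x + 2 * h) by ring.
replace (x + h - h) with x by ring.
replace (x - h + h) with x by ring.
replace (x - h - h) with (x + -2 * h) by ring.
replace (x + 1 * h) with (x + h) by ring.
replace (x + -1 * h) with (x - h) by ring.
ring.
Qed.

Lemma filterlim_pair_0 {T : Type} (F : (T -> Prop) -> Prop) {FF : Filter F}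
    (f g : T -> R) (l m : R) :
  filterlim f F (locally l) -> filterlim g F (locally m) ->
  filterlim (fun h => (f h - l, g h - m)) F (locally ((0, 0) : state)).
Proof.
intros Hf Hg; apply filterlim_locally; intros eta.
generalize (filter_and _ _ (proj1 (filterlim_locally f l) Hf eta)
  (proj1 (filterlim_locally g m) Hg eta)).
apply filter_imp; intros h [H1 H2].
assert (K1 : Rabs (f h - l) < eta) by exact H1.
assert (K2 : Rabs (g h - m) < eta) by exact H2.
split.
- change (Rabs (f h - l - 0) < eta); now rewrite Rminus_0_r.
- change (Rabs (g h - m - 0) < eta); now rewrite Rminus_0_r.
Qed.

(** With [eps] fixed, the characteristic speed and [/ eps] are constants, so the truncation error is
    a fixed linear combination of difference quotients and of the source. *)
Lemma upwind_consistent (mu a : R) :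
  0 < mu -> consistent burgers_flux mu a (upwind_scheme burgers_flux mu a).
Proof.
intros Hmu eps Heps u v Su Sv x t Ht.
assert (HK : 0 < mu / eps + a ^ 2).
{ assert (0 < mu / eps) by (apply Rdiv_lt_0_compat; lra).
  generalize (pow2_ge_0 a); lra. }
set (K := mu / eps + a ^ 2) in *.
set (c := char_speed mu a eps).
assert (Ux := is_derive_partial_x 0 0 u x t Su Ht).
assert (Vx := is_derive_partial_x 0 0 v x t Sv Ht).
assert (Ut := is_derive_partial_t 0 0 u x t Su Ht).
assert (Vt := is_derive_partial_t 0 0 v x t Sv Ht).
(* The implicit source is evaluated at [t + dt]; continuity in time brings it back to [t]. *)
set (G := fun s => burgers_flux (u x s) - v x s).
assert (HG : filterlim (fun h => G (t + h)) (at_right 0) (locally (G t))).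
{ apply filterlim_comp with (locally t).
  - apply filterlim_locally; intros eta; exists eta; intros h Hh _.
    change (Rabs (t + h - t) < eta); replace (t + h - t) with (h - 0) by ring.
    exact Hh.
  - apply (ex_derive_continuous G).
    exists (/ 2 * (INR 2 * partial_derive 0 1 u x t * partial_derive 0 0 u x t ^ 1)
      - partial_derive 0 1 v x t).
    apply (is_derive_minus (fun s => burgers_flux (u x s)) (fun s => v x s));
      [| exact Vt].
    unfold burgers_flux.
    apply (is_derive_scal (fun s => u x s ^ 2)), (is_derive_pow (fun s => u x s)), Ut. }
set (F := filter_prod (at_right 0) (at_right 0)).
(* After division by [dt] the flux terms depend on [dx] alone and the others on [dt] alone, so each
   limit is pulled back along a projection, with no relation between the two steps. *)
assert (space : forall (A : R -> R) (l : R), filterlim A (at_right 0) (locally l) ->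
  filterlim (fun h : R * R => A (fst h)) F (locally l)).
{ intros A l HA; exact (filterlim_comp _ _ _ fst A F _ _ filterlim_fst HA). }
assert (time : forall (A : R -> R) (l : R), filterlim A (at_right 0) (locally l) ->
  filterlim (fun h : R * R => A (snd h)) F (locally l)).
{ intros A l HA; exact (filterlim_comp _ _ _ snd A F _ _ filterlim_snd HA). }
assert (L1 := filterlim_linear F _ _ 1 1 _ _
  (time _ _ (filterlim_diff_quotient _ _ _ 1 Ut))
  (filterlim_linear F _ _ 1 (c / 8) _ _
    (space _ _ (filterlim_central_diff _ _ _ Vx))
    (space _ _ (filterlim_fourth_diff (fun y => u y t) x (ex_intro _ _ Ux))))).
assert (L2 := filterlim_linear F _ _ 1 1 _ _
  (filterlim_linear F _ _ 1 (- / eps) _ _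
    (time _ _ (filterlim_diff_quotient _ _ _ 1 Vt)) (time _ _ HG))
  (filterlim_linear F _ _ K (c / 8) _ _
    (space _ _ (filterlim_central_diff _ _ _ Ux))
    (space _ _ (filterlim_fourth_diff (fun y => v y t) x (ex_intro _ _ Vx))))).
assert (L := filterlim_pair_0 F _ _ _ _ L1 L2).
(* The rewriting of the truncation error holds for positive [dx] and [dt], hence eventually. *)
refine (filterlim_ext_loc _ _ _ L).
exists (fun h => 0 < h) (fun h => 0 < h);
  [exists (mkposreal 1 Rlt_0_1); trivial | exists (mkposreal 1 Rlt_0_1); trivial |].
intros dx dt Hdx Hdt; simpl.
unfold difference_operator, relaxation_operator.
rewrite upwind_scheme_sample by (trivial; lra).
fold K c; unfold sample, G; simpl.
unfold minus, plus, opp, scal; simpl; unfold prod_plus, prod_opp, prod_scal; simpl.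
unfold plus, opp, scal; simpl; unfold mult; simpl.
unfold partial_derive; simpl.
rewrite !Rmult_0_l, !Rplus_0_r, !Rmult_1_l.
f_equal; field; repeat split; lra.
Qed.

(** * The mesh conditions expressed through powers of [eps] *)

Theorem proposition3p1
  (mu : R) (hmu : 0 < mu)
  (a : R) (D : R -> Prop)
  (hsub : at_right 0 (fun eps =>
     forall u, D u -> Rabs (Derive burgers_flux u) <= sqrt (mu / eps + a ^ 2)))
  (CFL : R) (hCFL : 0 < CFL < 1)
  (alpha beta : R)
  (halpha : 1 / 6 < alpha < 1 / 2)
  (hbeta : 2 / 3 < beta < 1) (hbeta_eq : beta = alpha + 1 / 2)
  (dx dt : R -> R)
  (hdx_pos : at_right 0 (fun eps => 0 < dx eps))
  (hdt : at_right 0 (fun eps => dt eps = CFL * dx eps / sqrt (mu / eps + a ^ 2)))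
  (hdx_O : big_O (fun eps => Rpower eps alpha) dx)
  (hdt_O : big_O (fun eps => Rpower eps beta) dt) :
  AP_coarse_regime burgers_flux mu a D (upwind_scheme burgers_flux mu a)
    (1 / 6) (2 / 3) alpha beta dx dt.
Proof.
split; [now apply upwind_consistent |].
split; [lra | split; [lra | split; [now split | split]]].
{ split; [apply big_O_is_domin with alpha | apply big_O_is_domin with beta];
    trivial; lra. }
apply upwind_converges_to_viscous; trivial.
- generalize (filter_and _ _ at_right_pos (filter_and _ _ hdx_pos hdt)).
  apply filter_imp; intros eps [Heps [Hdx ->]]; split; [trivial |].
  apply Rdiv_lt_0_compat; [now apply Rmult_lt_0_compat |].
  assert (0 < mu / eps) by now apply Rdiv_lt_0_compat.
  apply sqrt_lt_R0; generalize (pow2_ge_0 a); lra.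
- intros theta Htheta.
  (* The numerical viscosity [c * dx ^ 3] has order [3 * alpha - 1 / 2], which is positive exactly
     when [alpha > 1 / 6]. *)
  assert (Hvisc : big_O (fun eps => Rpower eps (- / 2 + (alpha + (alpha + alpha))))
    (fun eps => char_speed mu a eps * (dx eps * (dx eps * dx eps)))).
  { apply big_O_mult; [now apply big_O_char_speed | now repeat apply big_O_mult]. }
  (* A quarter of [theta] for each of the four error terms. *)
  assert (Hth : 0 < theta / 4) by lra.
  assert (V1 := big_O_vanishes alpha _ _ ltac:(lra) hdx_O Hth).
  assert (V2 := big_O_vanishes beta _ _ ltac:(lra) hdt_O Hth).
  assert (V3 := Rpower_vanishes 1 _ Rlt_0_1 Hth).
  assert (V4 := big_O_vanishes _ _ (theta / 4)
    (ltac:(lra) : 0 < - / 2 + (alpha + (alpha + alpha))) Hvisc Hth).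
  generalize (filter_and _ _ (filter_and _ _ V1 V2)
    (filter_and _ _ (filter_and _ _ at_right_pos V3) V4)).
  apply filter_imp; intros eps [[H1 H2] [[Heps H3] H4]].
  rewrite Rpower_1 in H3 by assumption.
  replace (dx eps ^ 3) with (dx eps * (dx eps * dx eps)) by ring.
  apply Rabs_le_between in H1, H2, H4; lra.
Qed.
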